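(* Let $G$ be a group and let $\lambda : G \to \operatorname{Aut} G$, $a \mapsto \lambda_a$, be a group homomorphism. Then the set $H_{\lambda} := \{ (\lambda_a, a) \mid a \in G \}$ is a subgroup of $\operatorname{Hol} G = \operatorname{Aut} G \ltimes G$ if and only if $$[G, \lambda(G)] := \{ b^{-1} \lambda_a(b) \mid a, b \in G \} \subseteq \operatorname{Ker} \lambda .$$ Moreover, if $H_{\lambda}$ is a subgroup of $\operatorname{Hol} G$, then it is regular, and therefore $(G, \cdot, \circ)$ is a skew left brace, where $\cdot$ is the group operation of $G$ and $a \circ b := a \cdot \lambda_a(b)$ for all $a,b \in G$.
   Context: The holomorph $\operatorname{Hol} G = \operatorname{Aut} G \ltimes G$ is the set of pairs $(f,a)$ with $f \in \operatorname{Aut} G$, $a \in G$, with product $(f,a)(g,b) = (fg, a f(b))$. A subgroup $H \le \operatorname{Hol} G$ acts on $G$ by $(f,a)\cdot b = a f(b)$; $H$ is called regular if for each $a \in G$ there is a unique $(f,x) \in H$ with $x f(a) = 1$ (equivalently, the action of $H$ on $G$ is free and transitive). A skew left brace is a triple $(G, \cdot, \circ)$ where $(G,\cdot)$ and $(G,\circ)$ are groups and $g_1 \circ (g_2 \cdot g_3) = (g_1 \circ g_2)\cdot g_1^{-1} \cdot (g_1 \circ g_3)$ for all $g_1,g_2,g_3 \in G$, where $g_1^{-1}$ is the inverse of $g_1$ in $(G,\cdot)$. *)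

(* Defs.v *)
From HB Require Import structures.
From mathcomp Require Import all_boot.
From mathcomp Require Import all_classical.

Set Implicit Arguments.
Unset Strict Implicit.
Unset Printing Implicit Defensive.

Local Open Scope group_scope.
Local Open Scope classical_set_scope.

(* Groups, possibly infinite, are [groupType]s.  The choice structure bundled
   in a [groupType] is not a restriction: under the classical axioms of
   [boolp], every type carries one ([gen_eqMixin], [gen_choiceMixin]). *)

Section Automorphisms.
Variable G : groupType.

Record autg := Autg {
  autg_fun :> G -> G;
  autgM : {morph autg_fun : x y / x * y};
  autg_bij : bijective autg_fun }.

HB.instance Definition _ := gen_eqMixin autg.
HB.instance Definition _ := gen_choiceMixin autg.

Lemma autgP (f g : autg) : f =1 g -> f = g.
Proof.
case: f g => [f fM fb] [g gM gb] /= /funext fg.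
by case: _ / fg in gM gb *; congr Autg; apply: Prop_irrelevance.
Qed.

Fact idM : {morph (@id G) : x y / x * y}. Proof. by []. Qed.

Definition autg_one := Autg idM (Bijective (frefl id) (frefl id)).

Fact autg_compM (f g : autg) : {morph f \o g : x y / x * y}.
Proof. by move=> x y; rewrite /= !autgM. Qed.

Definition autg_mul (f g : autg) :=
  Autg (@autg_compM f g) (bij_comp (autg_bij f) (autg_bij g)).

Fact autg_inv_subproof (f : autg) :
  exists2 g : autg, cancel f g & cancel g f.
Proof.
have [g fK gK] := autg_bij f.
have gM : {morph g : x y / x * y}.
  by move=> x y; apply: (can_inj fK); rewrite autgM !gK.
by exists (Autg gM (Bijective gK fK)).
Qed.

Definition autg_inv (f : autg) : autg := sval (cid2 (autg_inv_subproof f)).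

Lemma autg_funK (f : autg) : cancel f (autg_inv f).
Proof. by rewrite /autg_inv; case: cid2. Qed.

Lemma autg_invK (f : autg) : cancel (autg_inv f) f.
Proof. by rewrite /autg_inv; case: cid2. Qed.

Fact autg_mulA : associative autg_mul.
Proof. by move=> f g h; apply: autgP. Qed.

Fact autg_mul1g : left_id autg_one autg_mul.
Proof. by move=> f; apply: autgP. Qed.

Fact autg_mulg1 : right_id autg_one autg_mul.
Proof. by move=> f; apply: autgP. Qed.

Fact autg_mulVg : left_inverse autg_one autg_inv autg_mul.
Proof. by move=> f; apply: autgP => x /=; rewrite autg_funK. Qed.

Fact autg_mulgV : right_inverse autg_one autg_inv autg_mul.
Proof. by move=> f; apply: autgP => x /=; rewrite autg_invK. Qed.

HB.instance Definition _ :=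
  isGroup.Build autg autg_mulA autg_mul1g autg_mulg1 autg_mulVg autg_mulgV.

Lemma autg1E (x : G) : (1 : autg) x = x. Proof. by []. Qed.

Lemma autgME (f g : autg) (x : G) : (f * g) x = f (g x). Proof. by []. Qed.

Lemma autg1 (f : autg) : f 1 = 1.
Proof. by apply: (@mulgI _ (f 1)); rewrite -autgM !mulg1. Qed.

Lemma autgV (f : autg) : {morph f : x / x^-1}.
Proof. by move=> x; apply: (@mulgI _ (f x)); rewrite -autgM !mulgV autg1. Qed.

End Automorphisms.

Section Holomorph.
Variable G : groupType.

(* A record rather than [autg G * G], which already carries the direct
   product group structure. *)
Record hol := Hol { hol_aut : autg G; hol_elt : G }.

HB.instance Definition _ := gen_eqMixin hol.
HB.instance Definition _ := gen_choiceMixin hol.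

Definition hol_one := Hol 1 1.

Definition hol_mul (h k : hol) :=
  Hol (hol_aut h * hol_aut k) (hol_elt h * hol_aut h (hol_elt k)).

Definition hol_inv (h : hol) :=
  Hol (hol_aut h)^-1 ((hol_aut h)^-1 (hol_elt h)^-1).

Fact hol_mulA : associative hol_mul.
Proof.
by case=> [f a] [g b] [h c]; rewrite /hol_mul /= autgM !mulgA.
Qed.

Fact hol_mul1g : left_id hol_one hol_mul.
Proof. by case=> [f a]; rewrite /hol_mul /= !mul1g. Qed.

Fact hol_mulg1 : right_id hol_one hol_mul.
Proof. by case=> [f a]; rewrite /hol_mul /= autg1 !mulg1. Qed.

Fact hol_mulVg : left_inverse hol_one hol_inv hol_mul.
Proof. by case=> [f a]; rewrite /hol_mul /= -autgM !mulVg autg1. Qed.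

Fact hol_mulgV : right_inverse hol_one hol_inv hol_mul.
Proof.
case=> [f a]; rewrite /hol_mul /= -[f (_ _)]autgME !mulgV /=.
by congr Hol; apply: mulgV.
Qed.

HB.instance Definition _ :=
  isGroup.Build hol hol_mulA hol_mul1g hol_mulg1 hol_mulVg hol_mulgV.

Definition hol_act (h : hol) (b : G) : G := hol_elt h * hol_aut h b.

Definition regular (H : set hol) : Prop :=
  forall a : G, exists! h : hol, H h /\ hol_act h a = 1.

End Holomorph.

Definition subgroup (K : groupType) (H : set K) : Prop :=
  group_closed (mem H).

Section LambdaMaps.
Variables (G : groupType) (lam : {multiplicative G -> autg G}).

Definition graph_hol : set (hol G) := [set Hol (lam a) a | a in [set: G]].

(* [G, lambda(G)]: a set of elements, not the subgroup they generate. *)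
Definition commutator_set : set G :=
  [set x | exists a b : G, x = b^-1 * lam a b].

Definition kernel : set G := [set a | lam a = 1].

End LambdaMaps.

Definition group_law (T : Type) (op : T -> T -> T) : Prop :=
  associative op /\
  exists e : T, left_id e op /\ right_id e op /\
    forall x : T, exists y : T, op y x = e /\ op x y = e.

(* [(G, *, circ)] is a skew left brace, [*] being the law of the
   [groupType] [G]. *)
Definition skew_left_brace (G : groupType) (circ : G -> G -> G) : Prop :=
  group_law circ /\
  forall g1 g2 g3 : G, circ g1 (g2 * g3) = circ g1 g2 * g1^-1 * circ g1 g3.

(* Main.v *)
(* Since lambda is a homomorphism, both H_lambda being a subgroup and
   [G, lambda(G)] <= Ker lambda amount to the invariance
   lambda_{lambda_a(b)} = lambda_b: it says precisely that
   lambda_{a lambda_a(b)} = lambda_a lambda_b.  Under this invariance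
   c lambda_c(a) = 1 forces lambda_c = lambda_{a^-1}, hence
   c = lambda_{a^-1}(a^-1); this gives regularity, and this c is also the
   inverse of a for the circle operation. *)
Require Import Defs.
From HB Require Import structures.
From mathcomp Require Import all_boot.
From mathcomp Require Import all_classical.

Local Open Scope group_scope.
Local Open Scope classical_set_scope.

Section MultiplicativeGroups.
Variables (G H : groupType) (f : {multiplicative G -> H}).

(* MathComp has these two only for [UMagmaMorphism]s, where preservation of 1
   is part of the structure. *)
Lemma mult_gmulf1 : f 1 = 1.
Proof. by apply: (@mulgI _ (f 1)); rewrite -gmulfM !mulg1. Qed.

Lemma mult_gmulfV : {morph f : x / x^-1}.
Proof.
by move=> x; apply: (@mulgI _ (f x)); rewrite -gmulfM !mulgV mult_gmulf1.
Qed.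

End MultiplicativeGroups.

Section LambdaInvariance.
Variables (G : groupType) (lam : {multiplicative G -> autg G}).

Definition lam_invariant : Prop := forall a b : G, lam (lam a b) = lam b.

Lemma graph_holE (f : autg G) (a : G) :
  (Hol f a \in mem (graph_hol lam)) <-> lam a = f.
Proof.
split=> [/set_mem[b _ [<- <-]] // | <-].
by apply/mem_set; exists a.
Qed.

(** Applying [lam] to [b^-1 * lam a b] gives [(lam b)^-1 * lam (lam a b)]. *)
Lemma commutator_set_sub_kernelE :
  commutator_set lam `<=` kernel lam <-> lam_invariant.
Proof.
split=> [sub a b | inv _ [a [b ->]]].
  have: lam (b^-1 * lam a b) = 1 by apply: sub; exists a, b.
  by rewrite gmulfM mult_gmulfV => /(canRL (mulVKg _)) ->; rewrite mulg1.
by rewrite /kernel /= gmulfM inv mult_gmulfV mulVg.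
Qed.

Lemma subgroup_graph_holE : subgroup (graph_hol lam) <-> lam_invariant.
Proof.
split=> [/group_closedM closedM a b | inv].
  have mem_graph c : Hol (lam c) c \in mem (graph_hol lam).
    exact/graph_holE.
  have /graph_holE := closedM _ _ (mem_graph a) (mem_graph b).
  by rewrite /= gmulfM => /mulgI.
split=> [|[f a] [g b] /graph_holE <- /graph_holE <-].
  by apply/graph_holE; rewrite mult_gmulf1.
(* The quotient has element [a * lam a (lam b^-1 b^-1)]; under [lam], invariance strips both
   actions. *)
by apply/graph_holE; rewrite /= -mult_gmulfV gmulfM !inv.
Qed.

Lemma regular_graph_hol : lam_invariant -> regular (graph_hol lam).
Proof.
move=> inv a; set c := lam a^-1 a^-1.
have lam_c : lam c = lam a^-1 by exact: inv.
exists (Hol (lam c) c); split=> [|_ [[d _ <-]]].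
  split; first by exists c.
  by rewrite /hol_act /= lam_c -autgM mulVg autg1.
rewrite /hol_act /= => da1.
have lam_d : lam d = lam a^-1.
  (* By invariance, [lam] turns [d * lam d a = 1] into [lam d * lam a = 1]. *)
  have /eqP := congr1 lam da1.
  by rewrite gmulfM inv mult_gmulf1 mulg_eq1 mult_gmulfV => /eqP.
suff -> : d = c by [].
by move/eqP: da1; rewrite mulg_eq1 lam_d -autgV => /eqP.
Qed.

Lemma skew_left_brace_lam :
  lam_invariant -> skew_left_brace (fun a b : G => a * lam a b).
Proof.
(* In the brace identity, [a^-1] cancels the leading [a] of [a * lam a c]. *)
move=> inv; split; last by move=> a b c; rewrite autgM !mulgA mulgVK.
split=> [a b c|]; first by rewrite gmulfM inv autgM !mulgA.
exists 1; split=> [a|]; first by rewrite mult_gmulf1 mul1g.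
split=> [a | a]; first by rewrite autg1 mulg1.
exists (lam a^-1 a^-1); split; first by rewrite inv -autgM mulVg autg1.
(* Here [lam a] undoes [lam a^-1], which leaves [a * a^-1]. *)
by rewrite -autgME -gmulfM mulgV mult_gmulf1 mulgV.
Qed.

End LambdaInvariance.

Theorem theorem2p3 (G : groupType) (lam : {multiplicative G -> autg G}) :
  (subgroup (graph_hol lam) <-> commutator_set lam `<=` kernel lam) /\
  (subgroup (graph_hol lam) ->
    regular (graph_hol lam) /\
    skew_left_brace (fun a b : G => a * lam a b)).
Proof.
split; first by rewrite subgroup_graph_holE commutator_set_sub_kernelE.
rewrite subgroup_graph_holE => inv.
by split; [exact: regular_graph_hol | exact: skew_left_brace_lam].
Qed.
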